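(* Let $1\le p\le q\le\infty$ and let $L(X)$ be the free locally convex space over a Tychonoff space $X$. Then: (i) every $(p,q)$-limited subset of $L(X)$ has finite-dimensional linear span; (ii) $L(X)$ has the $GP_{(p,q)}$ property, the $sGP_{(p,q)}$ property and the $b$-$GP_{(p,q)}$ property; (iii) every locally convex space $E$ is a quotient space of $L(E)$ (i.e., there is a quotient continuous linear surjection $L(E)\to E$).
   Context: The free locally convex space over a Tychonoff space $X$ is a locally convex space $L(X)$ with a continuous map $i:X\to L(X)$ such that every continuous map $f$ from $X$ to a locally convex space $E$ extends uniquely to a continuous linear operator $\bar f:L(X)\to E$ with $f=\bar f\circ i$; its dual can be identified with $C(X)$. For $A\subseteq E$ and $\chi\in E'$, $\|\chi\|_A:=\sup\{|\chi(x)|:x\in A\cup\{0\}\}$. A sequence $(\chi_n)$ in $E'$ is weak$^*$ $p$-summable if $(\chi_n(x))_n\in\ell_p$ for every $x\in E$ (in $c_0$ if $p=\infty$). A nonempty $A\subseteq E$ is $(p,q)$-limited if for every weak$^*$ $p$-summable sequence $(\chi_n)$ in $E'$, $(\|\chi_n\|_A)_n\in\ell_q$ if $q<\infty$ and $\|\chi_n\|_A\to0$ if $q=\infty$. $E$ has the $GP_{(p,q)}$ (resp. $sGP_{(p,q)}$, $b$-$GP_{(p,q)}$) property if every $(p,q)$-limited set is relatively compact (resp. relatively sequentially compact, precompact in the strong topology $\beta(E,E')$). *)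

(* Defs.v *)
From HB Require Import structures.
From mathcomp Require Import all_boot all_order all_algebra.
From mathcomp Require Import all_classical all_reals all_analysis.
Set Implicit Arguments. Unset Strict Implicit. Unset Printing Implicit Defensive.
Import Order.TTheory GRing.Theory Num.Theory.
Import numFieldNormedType.Exports.
Local Open Scope classical_set_scope.
Local Open Scope ring_scope.

Definition tychonoff_space (X : topologicalType) : Prop :=
  completely_regular_space X /\ hausdorff_space X.

Section defs.
Variable R : realType.

Definition cont_linear (E F : tvsType R) (f : E -> F) : Prop :=
  (forall (a : R) (x y : E), f (a *: x + y) = a *: f x + f y) /\ continuous f.

Definition dual_elt (E : tvsType R) (chi : E -> R^o) : Prop := cont_linear chi.

Definition free_lcs (X : topologicalType) (L : tvsType R) (i : X -> L) : Prop :=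
  continuous i /\
  forall (E : tvsType R) (f : X -> E), continuous f ->
    exists! F : L -> E, cont_linear F /\ f = F \o i.

(** real sequences in l_p (p in [1, +oo]); for p = +oo this means c_0 *)
Definition in_lp (p : \bar R) (u : nat -> R) : Prop :=
  match p with
  | r%:E => cvg (series (fun n => `|u n| `^ r) @ \oo)
  | +oo%E => u @ \oo --> (0 : R)
  | -oo%E => False
  end.

Definition in_lq (q : \bar R) (a : nat -> \bar R) : Prop :=
  match q with
  | r%:E => (forall n, a n \is a fin_num) /\ in_lp q (fun n => fine (a n))
  | +oo%E => a @ \oo --> 0%:E
  | -oo%E => False
  end.

Definition normA (E : tvsType R) (A : set E) (chi : E -> R^o) : \bar R :=
  ereal_sup [set (`|chi x|)%:E | x in A `|` [set 0]].

Definition weak_star_summable (E : tvsType R) (p : \bar R)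
  (chi : nat -> E -> R^o) : Prop :=
  (forall n, dual_elt (chi n)) /\ forall x : E, in_lp p (fun n => chi n x).

Definition pq_limited (E : tvsType R) (p q : \bar R) (A : set E) : Prop :=
  A !=set0 /\
  forall chi : nat -> E -> R^o, weak_star_summable p chi ->
    in_lq q (fun n => normA A (chi n)).

Definition rel_compact (E : tvsType R) (A : set E) : Prop :=
  compact (closure A).

Definition rel_seq_compact (E : tvsType R) (A : set E) : Prop :=
  forall u : nat -> E, (forall n, A (u n)) ->
    exists (phi : nat -> nat) (l : E),
      {homo phi : n m / (n < m)%N >-> (n < m)%N} /\ (u \o phi) @ \oo --> l.

(** precompact in the strong topology beta(E,E'), whose 0-neighbourhood
    base consists of the sets {x | sup_{chi in B} |chi x| <= eps} with
    B a weak*-bounded subset of E' and eps > 0 *)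
Definition strong_precompact (E : tvsType R) (A : set E) : Prop :=
  forall B : set (E -> R^o),
    (forall chi, B chi -> dual_elt chi) ->
    (forall x : E, exists M : R, forall chi, B chi -> `|chi x| <= M) ->
    forall eps : R, 0 < eps ->
      exists F : set E, finite_set F /\
        forall a, A a -> exists2 f, F f & forall chi, B chi -> `|chi (a - f)| <= eps.

Definition GP (E : tvsType R) (p q : \bar R) : Prop :=
  forall A : set E, pq_limited p q A -> rel_compact A.
Definition sGP (E : tvsType R) (p q : \bar R) : Prop :=
  forall A : set E, pq_limited p q A -> rel_seq_compact A.
Definition bGP (E : tvsType R) (p q : \bar R) : Prop :=
  forall A : set E, pq_limited p q A -> strong_precompact A.

(** the linear span of A is finite-dimensional: A (hence its span) lies in
    the span of a finite family *)
Definition fin_dim_span (E : tvsType R) (A : set E) : Prop :=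
  exists s : seq E, forall a, A a ->
    exists c : nat -> R, a = \sum_(i < size s) c i *: nth 0 s i.

Definition quotient_map (E F : topologicalType) (T : E -> F) : Prop :=
  continuous T /\ (forall y, exists x, T x = y) /\
  (forall U : set F, open (T @^-1` U) -> open U).

End defs.

(* Main.v *)
Require Import Defs.
From HB Require Import structures.
From mathcomp Require Import all_boot all_order all_algebra.
From mathcomp Require Import all_classical all_reals all_analysis.
From mathcomp Require Import lra.
Import Order.TTheory GRing.Theory Num.Theory.
Import numFieldNormedType.Exports.
Local Open Scope classical_set_scope.
Local Open Scope ring_scope.
Set Implicit Arguments.
Unset Strict Implicit.

(** The universal property forces [L] to be the linear span of [X], so every
    element of [L] has a finite support in [X], and continuous functions on [X]
    extend to continuous functionals on [L]. If the supports of the elements of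
    a limited set [A] filled an infinite subset of [X], one could find disjoint
    open sets [U k], each meeting the support of some [a k] in [A], and functions
    supported in [U k] whose extensions [chi k] satisfy [chi k (a k) = 1]; each
    point of [L] is killed by all but finitely many [chi k], contradicting
    limitedness. Hence [A] lies in the span of finitely many points of [X]; the
    sequences [2^-n chi] show that every functional is bounded on [A], so the
    coordinates of [A] are bounded, which yields all the compactness properties.
    For (iii), the extension of the identity of [E] is a left inverse of
    [E -> L(E)], hence a quotient map. *)

(** * Locally convex topology induced by a linear map *)

Section initial_tvs.
Variables (R : realType) (V : lmodType R) (E : tvsType R).
Variable f : {linear V -> E}.

(** This alias carries both the module structure of [V] and the initial topology; it turns the span
    of [i X] into a locally convex space to which the universal property of [L] applies. *)
Definition initial_tvs : Type := initial_topology f.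
Local Notation W := initial_tvs.

HB.instance Definition _ := GRing.Lmodule.copy W V.
HB.instance Definition _ := Uniform.copy W (initial_topology f).

Let f_continuous : continuous (f : W -> E).
Proof. exact: initial_continuous. Qed.

Let add_continuous : continuous (fun x : W * W => x.1 + x.2).
Proof.
apply: (@continuous_comp_initial W (W * W)%type E f) => z /=.
rewrite /comp; under eq_fun do rewrite linearD.
apply: (@continuous_comp _ (E * E)%type _ (fun x : W * W => (f x.1, f x.2))
  (fun x => x.1 + x.2)); last exact: add_continuous.
apply: cvg_pair; (apply: cvg_comp; last exact: f_continuous).
  exact: cvg_fst.
exact: cvg_snd.
Qed.

Let scale_continuous : continuous (fun z : R^o * W => z.1 *: z.2).
Proof.
apply: (@continuous_comp_initial W (R^o * W)%type E f) => z /=.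
rewrite /comp; under eq_fun do rewrite linearZ_LR.
apply: (@continuous_comp _ (R^o * E)%type _ (fun x : R^o * W => (x.1, f x.2))
  (fun x => x.1 *: x.2)); last exact: scale_continuous.
apply: (@cvg_pair _ _ _ _ (nbhs z.1) (nbhs (f z.2))); first exact: cvg_fst.
by apply: cvg_comp; [exact: cvg_snd|exact: f_continuous].
Qed.

Let locally_convex : exists2 B : set_system W,
  (forall b, b \in B -> convex_set b) & basis B.
Proof.
have [B Bc [Bo Bb]] := @locally_convex R E.
exists [set f @^-1` b | b in B].
  move=> _ /set_mem[b Bb' <-] x y l; rewrite !inE /= => xb yb.
  have fl : f (conv l x y) = conv l (f x : convex_lmodType E) (f y).
    by rewrite [LHS](linearP f) [in LHS]linearZ_LR.
  by rewrite fl; apply/set_mem/Bc; apply/mem_set.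
split; first by move=> _ [b /Bo ob <-]; exists b.
move=> x A [_ /= [[U oU <-] Ux UA]].
have [b /= [Bb' bx] bU] := Bb (f x) U (open_nbhs_nbhs (conj oU Ux)).
exists (f @^-1` b); first by split => //; exists b.
by move=> y /bU; apply: UA.
Qed.

HB.instance Definition _ :=
  PreTopologicalNmodule_isTopologicalNmodule.Build W add_continuous.
HB.instance Definition _ :=
  TopologicalNmodule_isTopologicalLmodule.Build R W scale_continuous.
HB.instance Definition _ := Uniform_isTvs.Build R W locally_convex.

Lemma initial_tvs_continuous : continuous (f : W -> E).
Proof. exact: initial_continuous. Qed.

Lemma continuous_initial_tvs (T : topologicalType) (g : T -> W) :
  continuous (f \o g : T -> E) -> continuous g.
Proof. exact: (@continuous_comp_initial W T E f). Qed.

End initial_tvs.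

(** * Sets with bounded coordinates over finitely many vectors *)

Lemma tvs_cvg_lincomb (R : realType) (E : tvsType R) (T J : Type)
    (F : set_system T) (FF : Filter F) (s : seq J) (b : J -> E)
    (c : J -> T -> R^o) (l : J -> R^o) :
  (forall k, c k @ F --> l k) ->
  (fun t => \sum_(k <- s) c k t *: b k) @ F --> \sum_(k <- s) l k *: b k.
Proof.
move=> cl; elim: s => [|k s IH].
  by rewrite big_nil; under eq_fun do rewrite big_nil; exact: cvg_cst.
rewrite big_cons; under eq_fun do rewrite big_cons.
apply: (@cvg_comp _ _ _ (fun t => (c k t *: b k, \sum_(k <- s) c k t *: b k))
   (fun x : E * E => x.1 + x.2) F (nbhs (l k *: b k, \sum_(k <- s) l k *: b k)));
  last exact: (@add_continuous E (_, _)).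
apply: cvg_pair => //.
apply: (@cvg_comp _ _ _ (fun t => (c k t, b k)) (fun x : R^o * E => x.1 *: x.2)
  F (nbhs (l k, b k))); last exact: (@scale_continuous R E (_, _)).
by apply: (@cvg_pair _ _ _ _ (nbhs (l k)) (nbhs (b k))); [exact: cl|exact: cvg_cst].
Qed.

(** Induction on [s]: Bolzano-Weierstrass for the new index refines the subsequence found so far,
    and refining preserves the limits already obtained. *)
Lemma bounded_subseq_cvg (R : realType) (J : Type) (s : seq J)
    (c : J -> nat -> R^o) :
  (forall k, exists M, forall n, `|c k n| <= M) ->
  exists phi : nat -> nat, {homo phi : n m / (n < m)%N >-> (n < m)%N} /\
    forall k, List.In k s -> cvg (c k (phi n) @[n --> \oo]).
Proof.
move=> bc; elim: s => [|k s [phi [phi_incr phi_cvg]]]; first by exists id; split=> // ? [].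
have [|f /leW_mono f_incr f_cvg] := @bolzano_weierstrass R (c k \o phi).
  have [M cM] := bc k; exists M; split; first exact: num_real.
  by move=> x Mx n _ /=; apply: le_trans (cM _) (ltW Mx).
have f_lt n i : (n < i)%N -> (f n < f i)%N by exact: etrans (f_incr n i).
exists (phi \o f); split; first by move=> n i nk; exact/phi_incr/f_lt.
move=> j [<-//|/phi_cvg/cvg_ex[l cl]].
apply/cvg_ex; exists l.
apply: (@cvg_comp _ _ _ f (fun n => c j (phi n)) \oo \oo) => //.
apply/cvgnyPge => A; near=> n.
rewrite (@leq_trans n)//; first by near: n; exact: nbhs_infty_ge.
by elim: (n) => // i IH; exact: leq_ltn_trans IH (f_lt _ _ (ltnSn _)).
Unshelve. all: by end_near. Qed.

Section bounded_coordinates.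
Variables (R : realType) (E : tvsType R) (m : nat).
Variables (b : 'I_m -> E) (c : 'I_m -> E -> R^o) (A : set E).
Hypothesis A_span : forall a, A a -> a = \sum_k c k a *: b k.
Hypothesis A_bnd : forall k, exists M, forall a, A a -> `|c k a| <= M.

Let A_bound : exists M : R, 0 <= M /\ forall a, A a -> forall k, `|c k a| <= M.
Proof.
have /choice[M cM] := A_bnd; exists (\sum_k `|M k|).
split=> [|a Aa k]; first exact: sumr_ge0.
rewrite (le_trans (cM k a Aa))// (le_trans (ler_norm _))//.
by rewrite (bigD1 k)//= lerDl sumr_ge0.
Qed.

(** The image of a coordinate cube under a continuous map is compact, and closed because [E] is
    Hausdorff, so it contains the closure of [A]. *)
Lemma bounded_coordinates_rel_compact : hausdorff_space E -> rel_compact A.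
Proof.
move=> hausE; have [M [M0 cM]] := A_bound.
pose K := [set v : 'rV[R]_m | forall k, `[(- M), M]%classic (v ord0 k)].
pose f (v : 'rV[R]_m) := \sum_k (v ord0 k : R^o) *: b k.
have cK : compact K.
  by apply: (@rV_compact _ _ (fun=> `[(- M), M]%classic)) => _; exact: segment_compact.
have cfK : compact (f @` K).
  apply: continuous_compact cK; apply: continuous_subspaceT => v.
  apply: (@tvs_cvg_lincomb R E _ _ (nbhs v) _ _ b (fun k w => w ord0 k)
    (fun k => v ord0 k)) => k.
  exact: coord_continuous.
apply: (subclosed_compact _ cfK); first exact: closed_closure.
rewrite ((closure_id _).1 (compact_closed hausE cfK)).
apply: closureS => a Aa; exists (\row_k (c k a)); last first.
  by rewrite [RHS](A_span Aa); apply: eq_bigr => k _; rewrite mxE.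
by move=> k /=; rewrite mxE in_itv/= -ler_norml cM.
Qed.

Lemma bounded_coordinates_rel_seq_compact : rel_seq_compact A.
Proof.
have [M [M0 cM]] := A_bound => u Au.
have [|phi [phi_incr phi_cvg]] :=
  @bounded_subseq_cvg R _ (index_enum 'I_m) (fun k n => c k (u n)).
  by move=> k; exists M => n; exact: cM.
have /choice[l cl] : forall k, exists l : R^o, c k (u (phi n)) @[n --> \oo] --> l.
  move=> k; apply/cvg_ex; apply: phi_cvg.
  by have := mem_index_enum k; elim: index_enum => //= j s IH;
    rewrite inE => /orP[/eqP ->|/IH]; [left|right].
exists phi, (\sum_k l k *: b k); split => //.
have -> : u \o phi = fun n => \sum_k c k (u (phi n)) *: b k.
  by apply/funext => n /=; rewrite [LHS]A_span.
exact: tvs_cvg_lincomb.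
Qed.

(** The finite set is a grid of mesh [d] on the coordinate cube. As [B] is bounded at each [b k],
    rounding coordinates down to the grid moves the values of all [chi] in [B] by at most [eps]. *)
Lemma bounded_coordinates_strong_precompact : strong_precompact A.
Proof.
move=> B Bdual Bbnd eps eps0; have [M [M0 cM]] := A_bound.
have /choice[N BN] : forall k, exists N : R, forall chi, B chi -> `|chi (b k)| <= N.
  by move=> k; exact: Bbnd.
(* The summand 1 keeps [S] positive, so that [eps] can be divided by it. *)
pose S := 1 + \sum_k `|N k|.
have S0 : 0 < S by rewrite ltr_pwDl// sumr_ge0.
pose d := eps / S; have d0 : 0 < d by rewrite divr_gt0.
pose P := Num.truncn ((M + M) / d).
pose g (j : {ffun 'I_m -> 'I_P.+1}) := \sum_k ((j k)%:R * d - M) *: b k.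
exists (range g); split; first exact/finite_image/finite_finset.
move=> a Aa.
(* [t k] is the distance of the coordinate from [-M] in units of the mesh; its truncation is the
   grid index. *)
pose t k := (c k a + M) / d.
have cak k : - M <= c k a <= M by rewrite -ler_norml cM.
have t0 k : 0 <= t k.
  apply: divr_ge0; last exact: ltW.
  by rewrite -lerBlDr sub0r; case/andP: (cak k).
have tP k : (Num.truncn (t k) < P.+1)%N.
  rewrite ltnS; apply: le_truncn; rewrite ler_pM2r ?invr_gt0// lerD2r.
  by case/andP: (cak k).
exists (g [ffun k => Ordinal (tP k)]); first by exists [ffun k => Ordinal (tP k)].
move=> chi Bchi; have [chi_lin _] := Bdual _ Bchi.
pose h : {linear E -> R^o} := HB.pack chi (GRing.isLinear.Build R E R^o _ chi chi_lin).
have -> : chi (a - g [ffun k => Ordinal (tP k)]) =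
    \sum_k (c k a - ((Num.truncn (t k))%:R * d - M)) * chi (b k).
  rewrite {1}(A_span Aa) -sumrB -[chi]/(h : E -> R^o) linear_sum.
  apply: eq_bigr => k _; rewrite ffunE /= -scalerBl.
  exact: (linearZ_LR h).
have -> : eps = d * S by rewrite /d divfK ?gt_eqF.
rewrite (le_trans (ler_norm_sum _ _ _))//.
apply: (@le_trans _ _ (\sum_k d * `|N k|)); last first.
  by rewrite -mulr_sumr ler_pM2l// lerDr.
apply: ler_sum => k _; rewrite normrM ler_pM//; last first.
  exact: le_trans (BN _ _ Bchi) (ler_norm _).
have /andP[h1 h2] := truncn_itv (t0 k).
have ck : c k a = t k * d - M by rewrite divfK ?gt_eqF// addrK.
rewrite {1}ck opprB addrA subrK -mulrBl normrM (gtr0_norm d0).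
rewrite ger_pMl// ger0_norm ?subr_ge0//.
by rewrite lerBlDr nat1r ltW.
Qed.

End bounded_coordinates.

(** * Disjoint open sets in Tychonoff spaces *)

Section tychonoff.
Variables (R : realType) (X : topologicalType).
Hypothesis hX : tychonoff_space X.

(** Complete regularity separates [x] from the complement of [U] joined with [F] minus [x], which is
    closed because finite sets are closed in a Hausdorff space. *)
Lemma tychonoff_bump (x : X) (U F : set X) : open U -> U x -> finite_set F ->
  exists f : X -> R^o, [/\ continuous f, f x = 1, forall y, ~ U y -> f y = 0 &
    forall y, F y -> y != x -> f y = 0].
Proof.
case: hX => crX hausX oU Ux finF.
pose B := ~` U `|` (F `\ x).
have clB : closed B.
  apply: closedU; first exact: open_closedC.
  have /accessible_finite_set_closed := hausdorff_accessible hausX.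
  by apply; exact: finite_setD.
have nBx : ~ B x by case=> [/(_ Ux)|[_ /(_ erefl)]].
have [g [gc _ g0 g1]] := (uniform_separatorP (R := R) _ _).1 (crX _ _ clB nBx).
have gB y : B y -> 1 - g y = 0 by move=> By; rewrite (_ : g y = 1) ?subrr//; apply: g1; exists y.
exists (fun y => 1 - g y); split.
- by move=> y; apply: (@cvgB _ R^o); [exact: cvg_cst|exact: gc].
- by rewrite (_ : g x = 0) ?subr0//; apply: g0; exists x.
- by move=> y nUy; apply: gB; left.
- by move=> y Fy /eqP yx; apply: gB; right.
Qed.

(** A function with value 1 at [a] and 0 at [b] cuts [W] into two sides. A side keeping infinitely
    many points of [S] becomes the last component, and the point on the other side is extracted with
    its neighbourhood. *)
Lemma infinite_split_open (S W : set X) : open W -> infinite_set (S `&` W) ->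
  exists t : X * set X * set X,
    [/\ S t.1.1, t.1.2 t.1.1, open t.1.2, t.1.2 `<=` W &
     [/\ open t.2, infinite_set (S `&` t.2), t.2 `<=` W & t.1.2 `&` t.2 = set0]].
Proof.
move=> oW infSW.
have [a [Sa Wa]] : (S `&` W) !=set0.
  by apply: infinite_setN0.
have [b [[Sb Wb] /eqP ba]] : ((S `&` W) `\ a) !=set0.
  by apply: infinite_setN0; apply: infinite_setD.
have [g [gc ga _ gb]] := tychonoff_bump openT (I : setT a) (finite_set1 b).
have {}gb : g b = 0 by apply: gb.
have ol (r : R) : open [set y | g y < r].
  exact: (open_comp (fun y _ => gc y) (@open_lt R r)).
have og (r : R) : open [set y | r < g y].
  exact: (open_comp (fun y _ => gc y) (@open_gt R r)).
have [inf|fin] := pselect (infinite_set (S `&` (W `&` [set y | g y < 1 / 2]))).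
  exists (a, W `&` [set y | 1 / 2 < g y], W `&` [set y | g y < 1 / 2]) => /=.
  split=> //=.
  - by split => //; rewrite /= ga; lra.
  - exact: openI.
  split=> //; first exact: openI.
  by rewrite -subset0 => y [[_ /= h1] [_ /= h2]]; lra.
exists (b, W `&` [set y | g y < 1 / 3], W `&` [set y | 1 / 3 < g y]) => /=.
split=> //=.
- by split => //; rewrite /= gb; lra.
- exact: openI.
split=> //; first exact: openI.
(* The sets where [g < 1 / 2] and where [1 / 3 < g] overlap and cover [W], so they cannot both meet
   [S] in finitely many points of [W]. *)
- move=> fin'; apply: infSW; apply: sub_finite_set (_ : finite_set (_ `|` _)).
    2: by rewrite finite_setU; split; [exact: contrapT fin|exact: fin'].
  move=> y [Sy Wy]; case: (ltP (g y) (1 / 2)) => h; [left|right]; split=> //.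
  by split => //=; lra.
- by rewrite -subset0 => y [[_ /= h1] [_ /= h2]]; lra.
Qed.

(** The splitting is iterated: [U n] is cut out of the remainder [W n] and misses [W n.+1], which
    contains all later [U m]. *)
Lemma infinite_disjoint_opens (S : set X) : infinite_set S ->
  exists (y : nat -> X) (U : nat -> set X),
    [/\ forall n, S (y n), forall n, U n (y n), forall n, open (U n) &
      trivIset setT U].
Proof.
move=> infS.
have /choice[F FP] : forall W : set X, exists t : X * set X * set X,
    open W -> infinite_set (S `&` W) ->
    [/\ S t.1.1, t.1.2 t.1.1, open t.1.2, t.1.2 `<=` W &
     [/\ open t.2, infinite_set (S `&` t.2), t.2 `<=` W & t.1.2 `&` t.2 = set0]].
  move=> W; have [[oW infW]|nW] := pselect (open W /\ infinite_set (S `&` W)).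
    by have [t] := infinite_split_open oW infW; exists t.
  (* A default triple for the [W] that cannot be split, since the choice function must be total. *)
  have /infinite_setN0[x _] := infS.
  by exists (x, set0, set0) => ? ?; exfalso; exact: nW.
pose W n := iter n (fun V => (F V).2) setT.
have Wgood n : open (W n) /\ infinite_set (S `&` W n).
  elim: n => [|n [oW infW]]; first by rewrite /W/= setIT; split=> //; exact: openT.
  by have [_ _ _ _ []] := FP _ oW infW.
have {}FP n := FP (W n) (Wgood n).1 (Wgood n).2.
have Wdecr n m : (n <= m)%N -> W m `<=` W n.
  move=> /subnK <-; elim: (m - n)%N => [//|k IH]; apply: subset_trans IH.
  by have [_ _ _ _ []] := FP (k + n)%N.
exists (fun n => (F (W n)).1.1), (fun n => (F (W n)).1.2); split.
1,2,3: by move=> n; have [] := FP n.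
apply/trivIsetP => n m _ _.
wlog nm : n m / (n < m)%N => [H|_].
  by rewrite neq_ltn => /orP[] h; [|rewrite setIC]; apply: H; rewrite // ltn_eqF.
have [_ _ _ _ [_ _ _ dis]] := FP n; have [_ _ _ sub _] := FP m.
by rewrite -subset0 -dis => x [Ux /sub/(Wdecr _ _ nm) Wx]; split.
Qed.

End tychonoff.

(** * Summable sequences and limited sets *)

Lemma in_lq_lt1 (R : realType) (q : \bar R) (a : nat -> \bar R) :
  (0 < q)%E -> in_lq q a -> exists n, (a n < 1)%E.
Proof.
case: q => [r| |]//=.
  rewrite lte_fin => r0 [afin /cvg_series_cvg_0/cvgr0_norm_lt/(_ _ ltr01)[N _ HN]].
  exists N; have := HN N (leqnn N); rewrite /= ger0_norm ?powR_ge0// => aN.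
  rewrite -(fineK (afin N)) lte_fin; move: aN; apply: contra_lt => h.
  rewrite -(congr1 (@^~ r) (@powR1 R)) ge0_ler_powR ?nnegrE//; first exact: ltW.
  exact: le_trans h (ler_norm _).
move=> _ acvg.
have : nbhs (0%:E : \bar R) [set x | (x < 1)%E].
  apply: open_nbhs_nbhs; split; last by rewrite /= lte_fin.
  exact: open_ereal_lt_ereal.
by move=> /acvg[N _ HN]; exists N; exact: (HN N (leqnn N)).
Qed.

Lemma in_lp_near0 (R : realType) (p : \bar R) (u : nat -> R) :
  (0 < p)%E -> (\forall n \near \oo, u n = 0) -> in_lp p u.
Proof.
case: p => [r| |]//=; last by move=> _ u0; exact: cvg_near_cst.
rewrite lte_fin => r0 [N _ uN].
rewrite -(is_cvg_series_restrict N).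
apply: (@is_cvg_near_cst _ _ 0); exists N => // n /= _.
rewrite big_nat_cond big1// => k /andP[/andP[Nk _] _].
by rewrite (uN k Nk) normr0 powR0 ?gt_eqF.
Qed.

Lemma in_lp_geometric (R : realType) (p : \bar R) (x : R) :
  (0 < p)%E -> in_lp p (fun n => 2^-1 ^+ n * x).
Proof.
case: p => [r| |]//= => [|_].
  rewrite lte_fin => r0.
  have z1 : (2^-1 : R) `^ r < 1.
    have := @gt0_ltr_powR R r r0 2^-1 1.
    by rewrite powR1 !nnegrE; apply; lra.
  rewrite [X in series X](_ : _ = geometric (`|x| `^ r) ((2^-1 : R) `^ r)).
    by apply: is_cvg_geometric_series; rewrite ger0_norm ?powR_ge0.
  apply/funext => n /=; rewrite normrM ger0_norm ?exprn_ge0// mulrC powRM//.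
    by congr (_ * _); rewrite -powR_mulrn// powRAC powR_mulrn// powR_ge0.
rewrite -[X in _ --> X](mul0r x); apply: cvgM; last exact: cvg_cst.
by apply: cvg_expr; rewrite ger0_norm//; lra.
Qed.

Section pq_limited.
Variables (R : realType) (E : tvsType R) (p q : \bar R).
Hypotheses (p0 : (0 < p)%E) (q0 : (0 < q)%E).
Variable A : set E.
Hypothesis limA : pq_limited p q A.

(** The form in which limitedness is used below: the norms on [A] tend to 0, so one of them is less
    than 1. *)
Lemma pq_limited_lt1 (chi : nat -> E -> R^o) : weak_star_summable p chi ->
  exists n, forall a, A a -> `|chi n a| < 1.
Proof.
move=> /limA.2/(in_lq_lt1 q0)[n nA]; exists n => a Aa.
rewrite -lte_fin; apply: le_lt_trans nA.
by apply: ereal_sup_ubound; exists a => //; left.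
Qed.

Lemma pq_limited_bounded (chi : E -> R^o) : dual_elt chi ->
  exists M, forall a, A a -> `|chi a| <= M.
Proof.
move=> [chiL chiC].
have [|n nA] := @pq_limited_lt1 (fun n x => 2^-1 ^+ n * chi x).
  split; last by move=> x; exact: in_lp_geometric.
  move=> n; split.
    by move=> a x y; rewrite chiL mulrDr; congr (_ + _); exact: mulrCA.
  by move=> x; apply: cvgM; [exact: cvg_cst|exact: chiC].
exists (2 ^+ n) => a /nA /ltW.
rewrite normrM ger0_norm ?exprn_ge0// exprVn mulrC ler_pdivrMr ?exprn_gt0//.
by rewrite mul1r.
Qed.

End pq_limited.

(** * Linear spans and reduced representations *)

Section span.
Variables (R : realType) (V : lmodType R) (X : choiceType) (i : X -> V).

Definition in_span : {pred V} :=
  fun v => `[< exists l : seq (R * X), v = \sum_(p <- l) p.1 *: i p.2 >].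

Let in_span_submod_closed : submod_closed in_span.
Proof.
split=> [|a u v]; first by apply/asboolP; exists [::]; rewrite big_nil.
move=> /asboolP[l ->] /asboolP[l' ->]; apply/asboolP.
exists ([seq (a * p.1, p.2) | p <- l] ++ l').
rewrite big_cat big_map scaler_sumr /=; congr (_ + _).
by apply: eq_bigr => p _; rewrite scalerA.
Qed.

HB.instance Definition _ := GRing.isSubmodClosed.Build R V in_span
  in_span_submod_closed.

(** The span is a type of its own so that its inclusion into [V] is a linear map, along which a
    topology can be induced. *)
Record span_of := SpanOf { span_val :> V ; _ : span_val \in in_span }.

HB.instance Definition _ := [isSub for span_val].
HB.instance Definition _ := [Choice of span_of by <:].
HB.instance Definition _ := [SubChoice_isSubLmodule of span_of by <:].

Lemma mem_in_span x : i x \in in_span.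
Proof. by apply/asboolP; exists [:: (1, x)]; rewrite big_seq1 scale1r. Qed.

(** Coefficients of repeated points are added up, and points with total 0 are dropped; the remaining
    list serves as the support of [v]. *)
Lemma in_span_reduced v : v \in in_span -> exists (s : seq X) (c : X -> R),
  [/\ uniq s, forall x, x \in s -> c x != 0 & v = \sum_(x <- s) c x *: i x].
Proof.
move=> /asboolP[l ->].
pose c x := \sum_(p <- l | p.2 == x) p.1.
exists [seq x <- undup [seq p.2 | p <- l] | c x != 0], c; split.
- by rewrite filter_uniq ?undup_uniq.
- by move=> x; rewrite mem_filter => /andP[].
rewrite big_filter [RHS]big_mkcond /=.
rewrite [RHS](eq_bigr (fun x => \sum_(p <- l | p.2 == x) p.1 *: i p.2)); last first.
  move=> x _; rewrite (eq_bigr (fun p => p.1 *: i x)) => [|p /eqP->//].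
  by rewrite -scaler_suml -/(c x); have [->|] := eqVneq (c x) 0; rewrite ?scale0r.
(* After the exchange, each pair [p] of [l] meets exactly one entry of the deduplicated list, namely
   [p.2]. *)
rewrite [RHS](exchange_big_dep xpredT)//= big_seq [RHS]big_seq.
apply: eq_bigr => p pl; rewrite -big_filter.
rewrite (_ : [seq _ <- _ | _] = [:: p.2]) ?big_seq1//.
rewrite (eq_filter (a2 := pred1 p.2)); last by move=> x; rewrite /= eq_sym.
by rewrite filter_pred1_uniq ?undup_uniq// mem_undup map_f.
Qed.

End span.

(** * Functionals and limited sets in the free locally convex space *)

Lemma separated_hausdorff (R : realType) (T : topologicalType) :
  (forall x y : T, x != y -> exists f : T -> R^o, continuous f /\ f x != f y) ->
  hausdorff_space T.
Proof.
move=> sepT x y xy; apply/eqP/negP => /negP/sepT[f [fc /eqP]]; apply.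
apply: (@Rhausdorff R) => A B /fc fA /fc fB.
by have [z [Az Bz]] := xy _ _ fA fB; exists (f z).
Qed.

Lemma dual_lincomb (R : realType) (E : tvsType R) (chi : E -> R^o) (J : Type)
    (s : seq J) (c : J -> R) (b : J -> E) : dual_elt chi ->
  chi (\sum_(x <- s) c x *: b x) = \sum_(x <- s) c x * chi (b x).
Proof.
move=> [chi_lin _].
pose h : {linear E -> R^o} := HB.pack chi (GRing.isLinear.Build R E R^o _ chi chi_lin).
rewrite -[chi]/(h : E -> R^o) linear_sum.
by apply: eq_bigr => x _; rewrite linearZ_LR.
Qed.

Section free_lcs_over_tychonoff.
Variables (R : realType) (X : topologicalType) (L : tvsType R) (i : X -> L).
Hypotheses (hX : tychonoff_space X) (hL : free_lcs i).

Lemma free_lcs_extension (g : X -> R^o) : continuous g ->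
  exists chi : L -> R^o, dual_elt chi /\ forall x, chi (i x) = g x.
Proof.
move=> /hL.2[chi [[chiL gE] _]]; exists chi; split => // x.
by rewrite gE.
Qed.

(* Extending [X -> span (i X)] to [L] and composing with the inclusion gives a
   continuous endomorphism of [L] agreeing with the identity on [i X]. *)
Lemma free_lcs_in_span a : a \in in_span i.
Proof.
pose v : {linear span_of i -> L} := \val.
pose g x : initial_tvs v := SpanOf (mem_in_span i x).
have gc : continuous g by apply: continuous_initial_tvs; exact: hL.1.
have [F [[[Flin Fc] gF] _]] := hL.2 _ g gc.
have [G [_ Guniq]] := hL.2 _ i hL.1.
have Gid : G = id.
  by apply: Guniq; split => //; split => // x; exact: cvg_id.
have GvF : G = v \o F.
  apply: Guniq; split; last by rewrite -compA -gF.
  split; first by move=> t x y; rewrite /= Flin; exact: (linearP v).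
  by move=> x; apply: continuous_comp; [exact: Fc|exact: initial_tvs_continuous].
rewrite -[a]/(id a) -Gid GvF; exact: (valP (F a : span_of i)).
Qed.

(** A bump function equal to 1 at [x] and 0 at the other points of [s] extends to the functional.
    The conditions on [s] and [x] come after the existential so that functionals can be chosen for
    all [x] at once. *)
Lemma free_lcs_coordinate (s : seq X) x : exists chi : L -> R^o, dual_elt chi /\
  forall c : X -> R, uniq s -> x \in s ->
    chi (\sum_(y <- s) c y *: i y) = c x.
Proof.
have [f [fc fx1 _ fs0]] := tychonoff_bump R hX openT (I : setT x) (finite_seq s).
have [chi [chi_dual chiE]] := free_lcs_extension fc.
exists chi; split => // c us xs.
rewrite dual_lincomb// (bigD1_seq x)//= chiE fx1 mulr1 big_seq_cond big1 ?addr0//.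
by move=> y /andP[ys yx]; rewrite chiE fs0 ?mulr0.
Qed.

(** If [a] and [b] differ, the coordinate functional at a point of the support of [a - b] separates
    them. *)
Lemma free_lcs_hausdorff : hausdorff_space L.
Proof.
apply: (@separated_hausdorff R) => a b; rewrite -subr_eq0.
have [[|x s] [c [us c0 abE]]] := in_span_reduced (free_lcs_in_span (a - b)).
  by rewrite abE big_nil eqxx.
move=> _; have xs : x \in x :: s by rewrite mem_head.
have [chi [[chi_lin chi_cont] chiE]] := free_lcs_coordinate (x :: s) x.
exists chi; split => //; apply: contraNneq (c0 x xs) => chi_ab.
rewrite -(chiE c us xs) -abE addrC -scaleN1r chi_lin chi_ab.
by rewrite scaleN1r addNr.
Qed.

Section pq_limited.
Variables (p q : \bar R).
Hypotheses (p0 : (0 < p)%E) (q0 : (0 < q)%E).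
Variable A : set L.
Hypothesis limA : pq_limited p q A.

Lemma pq_limited_finite_support : finite_set [set x | exists s c,
  [/\ uniq s, x \in s, c x != 0 & A (\sum_(y <- s) c y *: i y)]].
Proof.
apply: contrapT => /(infinite_disjoint_opens R hX)[y [U [yS Uy oU /trivIsetP tU]]].
have /choice[s /choice[c sc]] := yS.
(* Vanishing off [U k] will give summability; vanishing on the rest of [s k] isolates the
   coefficient of [y k]. *)
have /choice[f fP] : forall k, exists f : X -> R^o,
    [/\ continuous f, f (y k) = 1, forall x, ~ U k x -> f x = 0 &
      forall x, x \in s k -> x != y k -> f x = 0].
  by move=> k; exact: (tychonoff_bump R hX (oU k) (Uy k) (finite_seq (s k))).
pose g k x : R^o := (c k (y k))^-1 * f k x.
have /choice[chi chiP] : forall k, exists chi : L -> R^o,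
    dual_elt chi /\ forall x, chi (i x) = g k x.
  move=> k; apply: free_lcs_extension => x.
  by apply: cvgM; [exact: cvg_cst|have [fc _ _ _] := fP k; exact: fc].
have g0 n x : ~ U n x -> g n x = 0.
  by have [_ _ fU _] := fP n; move=> /fU fx0; rewrite /g fx0 mulr0.
(* By disjointness [x] lies in at most one [U k], and [k.+1] is then a threshold. *)
have g_near0 x : \forall n \near \oo, g n x = 0.
  have [[k Ukx]|nU] := pselect (exists k, U k x); last first.
    by exists 0%N => // n _; apply: g0 => Unx; apply: nU; exists n.
  exists k.+1 => // n /= kn; apply: g0 => Unx.
  have : (U k `&` U n) x by split.
  by rewrite tU ?ltn_eqF.
have [|n nA] := pq_limited_lt1 q0 limA (chi := chi).
  split=> [k|a]; first exact: (chiP k).1.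
  have [s' [c' [_ _ ->]]] := in_span_reduced (free_lcs_in_span a).
  apply: in_lp_near0 => //.
  (* The finitely many points supporting [a] share a threshold. *)
  have : \forall n \near \oo, forall x, x \in s' -> g n x = 0.
    elim: s' => [|x s' IH]; first by near=> n.
    near=> n => z; rewrite inE => /orP[/eqP ->|]; first by near: n; exact: g_near0.
    by move: z; near: n.
  apply: filterS => n gn0; rewrite dual_lincomb; last exact: (chiP n).1.
  by rewrite big_seq big1// => x xs; rewrite (chiP n).2 gn0 ?mulr0.
(* By the normalisation in [g], [chi n] equals 1 at the element of [A] given by [s n] and [c n],
   against [nA]. *)
have [us ys cy Aa] := sc n; have [_ fy _ fs] := fP n.
have := nA _ Aa; rewrite dual_lincomb; last exact: (chiP n).1.
rewrite (bigD1_seq (y n))//= (chiP n).2 /g fy mulr1 mulfV//.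
rewrite big_seq_cond big1 ?addr0 ?normr1 ?ltxx// => x /andP[xs xy].
by rewrite (chiP n).2 /g fs// !mulr0.
Unshelve. all: by end_near. Qed.

Lemma pq_limited_finite_span : exists s : seq X, uniq s /\
  forall a, A a -> exists c : X -> R, a = \sum_(x <- s) c x *: i x.
Proof.
have /finite_seqP[t tE] := pq_limited_finite_support.
exists (undup t); split=> [|a Aa]; first exact: undup_uniq.
have [s [c [us c0 aE]]] := in_span_reduced (free_lcs_in_span a).
(* Points of the common list outside the support [s] of [a] get coefficient 0. *)
exists (fun x => if x \in s then c x else 0).
rewrite (eq_bigr (fun x => if x \in s then c x *: i x else 0)); last first.
  by move=> x _; case: ifP; rewrite ?scale0r.
rewrite -big_mkcond -big_filter aE; apply: perm_big.
apply: uniq_perm => //; first by rewrite filter_uniq ?undup_uniq.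
move=> x; rewrite mem_filter mem_undup; apply/idP/andP => [xs|[]//].
split => //; have : [set` t] x by rewrite -tE; exists s, c; rewrite -aE; split => //; exact: c0.
by [].
Qed.

(** The coordinates are continuous functionals, hence bounded on [A]; this supplies the hypotheses
    of the compactness lemmas above. *)
Lemma pq_limited_coordinates : exists m (b : 'I_m -> L) (c : 'I_m -> L -> R^o),
  (forall a, A a -> a = \sum_k c k a *: b k) /\
  (forall k, exists M, forall a, A a -> `|c k a| <= M).
Proof.
have [s [us As]] := pq_limited_finite_span.
have /choice[chi chiP] := free_lcs_coordinate s.
pose t := tnth (in_tuple s).
exists (size s), (fun k => i (t k)), (fun k => chi (t k)); split.
  move=> a /As[c ->]; rewrite [LHS]big_tnth; apply: eq_bigr => k _.
  by rewrite (chiP _).2// mem_tnth.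
by move=> k; apply: (pq_limited_bounded p0 q0 limA); exact: (chiP _).1.
Qed.

End pq_limited.

End free_lcs_over_tychonoff.

(** * Finite-dimensional spans, quotients and the conclusion *)

Lemma coordinates_fin_dim_span (R : realType) (E : tvsType R) (A : set E) m
    (b : 'I_m -> E) (c : 'I_m -> E -> R^o) :
  (forall a, A a -> a = \sum_k c k a *: b k) -> fin_dim_span A.
Proof.
move=> A_span; exists [tuple b k | k < m] => a Aa.
(* [fin_dim_span] indexes coefficients by [nat]; those from [m] on get the default 0. *)
exists (fun n => oapp (c^~ a) 0 (insub n)); rewrite {1}(A_span a Aa).
rewrite -(big_mkord xpredT (fun n => oapp (c^~ a) 0 (insub n) *: nth 0 [tuple b k | k < m] n)).
rewrite size_tuple big_mkord; apply: eq_bigr => k _.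
by rewrite -tnth_nth tnth_mktuple valK.
Qed.

Lemma free_lcs_quotient (R : realType) (E LE : tvsType R) (j : E -> LE) :
  free_lcs j -> exists T : LE -> E, cont_linear T /\ quotient_map T.
Proof.
move=> [jc /(_ E id (fun x => cvg_id))[T [[Tlin Tj] _]]].
have TjE y : T (j y) = y by rewrite -[LHS]/((T \o j) y) -Tj.
exists T; split => //; split; first exact: Tlin.2.
split=> [y|U oTU]; first by exists (j y).
(* As [j] is a continuous section of [T], pulling the open preimage of [U] back along [j] recovers
   [U]. *)
have -> : U = j @^-1` (T @^-1` U) by apply/seteqP; split => y /=; rewrite TjE.
by apply: open_comp oTU => x _; exact: jc.
Qed.

Theorem theoremt (R : realType) (p q : \bar R)
  (hp : (1%:E <= p)%E) (hpq : (p <= q)%E)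
  (X : topologicalType) (hX : tychonoff_space X)
  (L : tvsType R) (i : X -> L) (hL : free_lcs i) :
  (forall A : set L, pq_limited p q A -> fin_dim_span A) /\
  (GP L p q /\ sGP L p q /\ bGP L p q) /\
  (forall (E : tvsType R), hausdorff_space E ->
     forall (LE : tvsType R) (j : E -> LE), free_lcs j ->
       exists T : LE -> E, cont_linear T /\ quotient_map T).
Proof.
have p0 : (0 < p)%E by exact: lt_le_trans hp.
have q0 : (0 < q)%E by exact: lt_le_trans hpq.
have coord A := @pq_limited_coordinates R X L i hX hL p q p0 q0 A.
split; [|split; [split; [|split]|]].
- by move=> A /coord[m [b [c [Aspan _]]]]; exact: coordinates_fin_dim_span Aspan.
- move=> A /coord[m [b [c [Aspan Abnd]]]].
  exact: bounded_coordinates_rel_compact Aspan Abnd (free_lcs_hausdorff hX hL).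
- move=> A /coord[m [b [c [Aspan Abnd]]]].
  exact: bounded_coordinates_rel_seq_compact Aspan Abnd.
- move=> A /coord[m [b [c [Aspan Abnd]]]].
  exact: bounded_coordinates_strong_precompact Aspan Abnd.
- by move=> E _ LE j; exact: free_lcs_quotient.
Qed.
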